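(* Let $k$ be a field of characteristic zero and let $e\le 5$ be a positive integer. Let $1\le i\le e-1$ and let $\alpha\ge 2$ be an integer. Let $h=(1,h_1,\dots,h_{e-1},1)$ be an integer sequence indexed by $0,1,\dots,e$, and for an integer $\beta$ let $h^{(\beta)}$ be the sequence obtained from $h$ by replacing the entry $h_j$ with $h_j+\beta$ for each $j\in\{i,e-i\}$ (so if $i=e-i$ only one entry is changed, and it is increased by $\beta$ once), all other entries being unchanged. If $h$ and $h^{(\alpha)}$ are both Gorenstein Hilbert functions, then $h^{(\beta)}$ is a Gorenstein Hilbert function for every $\beta=1,2,\dots,\alpha-1$.
   Context: Fix a field $k$ of characteristic zero. A standard graded artinian algebra is $A=R/I$ with $R=k[x_1,\dots,x_r]$, all variables of degree one, $I$ a homogeneous ideal containing no nonzero linear forms, and $\dim_k A<\infty$; $r$ is the codimension of $A$. The Hilbert function of $A$ is $h_j=\dim_k A_j$, identified with the vector $(1,h_1,\dots,h_e)$, where $e$ (the socle degree) is the largest index with $h_e>0$. The socle of $A$ is the annihilator of the maximal ideal $(\overline{x_1},\dots,\overline{x_r})$ in $A$; $A$ is Gorenstein if its socle is one-dimensional over $k$ (hence concentrated in degree $e$). A sequence is a Gorenstein Hilbert function (of socle degree $e$) if it is the Hilbert function of some such Gorenstein algebra $A$ over $k$ (of socle degree $e$). The codimension is arbitrary. *)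

(* Defs.v *)
From HB Require Import structures.
From mathcomp Require Import all_boot all_order all_algebra.
From mathcomp Require Import generic_quotient ring_quotient.
From mathcomp Require Import mpoly.

Set Implicit Arguments.
Unset Strict Implicit.
Unset Printing Implicit Defensive.

Import GRing.Theory.
Local Open Scope ring_scope.
Local Open Scope quotient_scope.

(* U is meant to be a k-subspace of V. *)
Definition is_dim (k : fieldType) (V : lmodType k) (U : V -> Prop) (n : nat)
    : Prop :=
  exists b : 'I_n -> V, (forall i, U (b i)) /\
    (forall v, U v -> exists! c : 'rV[k]_n, v = \sum_(i < n) c 0 i *: b i).

(* The library puts only a ring structure on {ideal_quot I}; this alias also
   carries the k-algebra structure of k[x_1..x_r]/I. An idealr is proper, so
   the quotient is nonzero. *)
Definition quot_alg (k : fieldType) (r : nat) (I : idealr {mpoly k[r]}) :=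
  {ideal_quot I}.

HB.instance Definition _ (k : fieldType) (r : nat) (I : idealr {mpoly k[r]}) :=
  GRing.ComNzRing.on (quot_alg I).

Section QuotAlg.
Variables (k : fieldType) (r : nat) (I : idealr {mpoly k[r]}).

Definition quot_class (p : {mpoly k[r]}) : quot_alg I := \pi_{ideal_quot I} p.

Definition quot_scale (c : k) (a : quot_alg I) : quot_alg I :=
  quot_class c%:MP * a.

Lemma quot_classD : {morph quot_class : p q / p + q}.
Proof. exact: (rmorphD (\pi_{ideal_quot I})). Qed.

Lemma quot_classM : {morph quot_class : p q / p * q}.
Proof. exact: (rmorphM (\pi_{ideal_quot I})). Qed.

Lemma quot_class1 : quot_class 1 = 1.
Proof. exact: (rmorph1 (\pi_{ideal_quot I})). Qed.

Lemma quot_scaleA c d a : quot_scale c (quot_scale d a) = quot_scale (c * d) a.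
Proof. by rewrite /quot_scale mulrA mpolyCM quot_classM. Qed.

Lemma quot_scale1 : left_id 1 quot_scale.
Proof. by move=> a; rewrite /quot_scale mpolyC1 quot_class1 mul1r. Qed.

Lemma quot_scaleDr : right_distributive quot_scale +%R.
Proof. by move=> c a b; rewrite /quot_scale mulrDr. Qed.

Lemma quot_scaleDl a : {morph quot_scale^~ a : c d / c + d}.
Proof. by move=> c d; rewrite /quot_scale mpolyCD quot_classD mulrDl. Qed.

HB.instance Definition _ := GRing.Zmodule_isLmodule.Build k (quot_alg I)
  quot_scaleA quot_scale1 quot_scaleDr quot_scaleDl.

Lemma quot_scaleAl (c : k) (a b : quot_alg I) : c *: (a * b) = c *: a * b.
Proof. exact: mulrA. Qed.

HB.instance Definition _ := GRing.Lmodule_isLalgebra.Build k (quot_alg I)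
  quot_scaleAl.

Definition homogeneous_ideal : Prop :=
  forall (p : {mpoly k[r]}) (d : nat), p \in I -> pihomog mdeg d p \in I.

Definition no_linear_forms : Prop :=
  forall p : {mpoly k[r]}, p \is 1.-homog -> p \in I -> p = 0.

Definition finite_dimensional : Prop :=
  exists n, is_dim (fun _ : quot_alg I => True) n.

Definition standard_graded_artinian : Prop :=
  [/\ homogeneous_ideal, no_linear_forms & finite_dimensional].

Definition graded_piece (j : nat) (a : quot_alg I) : Prop :=
  exists2 p : {mpoly k[r]}, p \is j.-homog & a = quot_class p.

Definition maximal_ideal (a : quot_alg I) : Prop :=
  exists b : 'I_r -> quot_alg I, a = \sum_(i < r) b i * quot_class 'X_i.

Definition socle (a : quot_alg I) : Prop :=
  forall m, maximal_ideal m -> m * a = 0.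

Definition gorenstein : Prop := is_dim socle 1.

Definition hilbert_function (H : nat -> nat) : Prop :=
  forall j, is_dim (graded_piece j) (H j).

End QuotAlg.

Definition socle_degree (H : nat -> nat) (e : nat) : Prop :=
  (0 < H e)%N /\ (forall j, (e < j)%N -> H j = 0%N).

Definition gorenstein_hilbert_function (k : fieldType) (e : nat)
    (h : 'I_e.+1 -> int) : Prop :=
  exists (r : nat) (I : idealr {mpoly k[r]}) (H : nat -> nat),
    [/\ standard_graded_artinian I, gorenstein I, hilbert_function I H,
        socle_degree H e & forall j : 'I_e.+1, h j = (H j)%:Z].

Definition shift_sym (e i : nat) (beta : int) (h : 'I_e.+1 -> int)
    (j : 'I_e.+1) : int :=
  if (j == i :> nat) || (j == (e - i)%N :> nat) then h j + beta else h j.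

(* Main.v *)
(* By Macaulay duality a Gorenstein algebra of socle degree e is k[x]/ann(phi)
   for a functional phi on k[x] supported in degree e, and its Hilbert function
   is given by the ranks of the catalecticants of phi.  For e <= 5 it is
   determined by (h_1, h_2).

   Raising h_2: if a quadric p annihilates phi and p(v) <> 0, then adding to phi
   the e-th power dual to v raises h_2 by exactly one and keeps h_1.

   Lowering h_1: phi restricts to a nondegenerate functional on k[W] for some W
   of any smaller dimension, and the catalecticant ranks do not grow.  Indeed,
   let W be maximal among the subspaces of linear forms with phi|k[W]
   nondegenerate, and Z the space of linear forms z with phi(z k[W]) = 0.
   Maximality gives phi(z^a k[W]) = 0 for all z in Z and a > 0; by polarization
   Z annihilates phi, so Z = 0 and W is everything. *)
Require Import Defs.
From HB Require Import structures.
From mathcomp Require Import all_boot all_order all_algebra.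
From mathcomp Require Import generic_quotient ring_quotient.
From mathcomp Require Import mpoly.
From mathcomp Require Import zify.
From Stdlib Require Import Classical.

Set Implicit Arguments.
Unset Strict Implicit.
Unset Printing Implicit Defensive.

Import GRing.Theory.
Local Open Scope ring_scope.

(** * Linear forms, substitution, and vanishing of univariate polynomial functions *)

Section Polynomials.
Variable k : fieldType.

Lemma pihomogK n (p : {mpoly k[n]}) : p = \sum_(d < msize p) pihomog mdeg d p.
Proof. exact: pihomog_partitionE. Qed.

Lemma linear_formE n (p : {mpoly k[n]}) :
  p \is 1.-homog -> p = \sum_(i < n) p@_U_(i) *: 'X_i.
Proof.
move=> hp; apply/mpolyP => m; rewrite raddf_sum /=.
have [/mdeg1P[i /eqP->]|m1] := boolP (mdeg m == 1%N).
  rewrite (bigD1 i) //= mcoeffZ mcoeffXU eqxx mulr1 big1 ?addr0 // => j ji.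
  by rewrite mcoeffZ mcoeffXU (negPf ji) mulr0.
rewrite (dhomog_nemf_coeff hp m1) big1 // => i _.
rewrite mcoeffZ mcoeffX; case: eqP => [mi|]; last by rewrite mulr0.
by rewrite -mi mdeg1 in m1.
Qed.

Lemma sum_linear_form n (c : 'I_n -> k) :
  \sum_(i < n) c i *: 'X_i \is [in k[n], 1.-homog].
Proof. by apply: rpred_sum => i _; rewrite rpredZ // dhomogX /= mdeg1. Qed.

Lemma coef_sum_linear_form n (c : 'I_n -> k) j :
  (\sum_(i < n) c i *: 'X_i : {mpoly k[n]})@_U_(j) = c j.
Proof.
rewrite raddf_sum (bigD1 j) //= mcoeffZ mcoeffXU eqxx mulr1 big1 ?addr0 //.
by move=> i ij; rewrite mcoeffZ mcoeffXU (negPf ij) mulr0.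
Qed.

Lemma homog_comp_mpoly n r d (w : n.-tuple {mpoly k[r]}) (p : {mpoly k[n]}) :
    (forall i, tnth w i \is 1.-homog) -> p \is d.-homog ->
  p \mPo w \is d.-homog.
Proof.
move=> hw hp; rewrite comp_mpolyE big_seq; apply: rpred_sum => m mp.
apply: rpredZ; have <- : mdeg m = d := dhomog_mf hp mp; rewrite mdegE.
elim/big_rec2: _ => [|i q d' _ hq]; first exact: dhomog1.
by apply: dhomogM hq; rewrite -[X in X.-homog](mul1n (m i)); apply: dhomogMn.
Qed.

Lemma comp_mpolyA n r s (v : n.-tuple {mpoly k[r]}) (w : r.-tuple {mpoly k[s]})
    (p : {mpoly k[n]}) :
  (p \mPo v) \mPo w = p \mPo [tuple (tnth v i \mPo w) | i < n].
Proof.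
rewrite [p \mPo v]comp_mpolyEX raddf_sum [RHS]comp_mpolyEX /=.
apply: eq_bigr => m _; rewrite !comp_mpolyZ !comp_mpolyX rmorph_prod /=.
by congr (_ *: _); apply: eq_bigr => i _; rewrite rmorphXn tnth_mktuple.
Qed.

(** In characteristic zero the integers below [size p] are that many distinct roots, more than the
    degree allows. *)
Lemma polyfun_eq0 (p : {poly k}) :
  [pchar k] =i pred0 -> (forall t, p.[t] = 0) -> p = 0.
Proof.
move=> /pcharf0P ch0 p0.
apply: (@roots_geq_poly_eq0 _ p [seq i%:R | i <- iota 0 (size p)]).
- by apply/allP => x _; rewrite /root p0.
- rewrite map_inj_uniq ?iota_uniq //.
  have inj i j : (i <= j)%N -> i%:R = j%:R :> k -> i = j.
    move=> ij /eqP; rewrite eq_sym -subr_eq0 -natrB // ch0 subn_eq0 => ji.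
    by apply/eqP; rewrite eqn_leq ij.
  move=> i j eij; have [/inj|/ltnW/inj] := leqP i j; first exact.
  by move=> h; apply/esym/h.
- by rewrite size_map size_iota.
Qed.

End Polynomials.

(** * Functionals in degree [e], their annihilators and catalecticants *)

Section Forms.
Variables (k : fieldType) (e : nat).

(* A form of degree [e] in [n] divided-power variables is encoded as the
   functional by which it pairs with polynomials. *)
Definition concentrated n (phi : {scalar {mpoly k[n]}}) :=
  forall m : 'X_{1..n}, mdeg m != e -> phi 'X_[m] = 0.

(** Membership in the apolar ideal of [phi], the largest ideal inside its kernel. *)
Definition annih n (phi : {scalar {mpoly k[n]}}) (p : {mpoly k[n]}) :=
  forall q, phi (p * q) = 0.

(** The form essentially involves all [n] variables. *)
Definition nondegenerate n (phi : {scalar {mpoly k[n]}}) :=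
  forall p, p \is 1.-homog -> annih phi p -> p = 0.

Section OneForm.
Variables (n : nat) (phi : {scalar {mpoly k[n]}}).
Hypothesis phi_e : concentrated phi.
Implicit Types p q : {mpoly k[n]}.

Lemma concentrated_homog d p : p \is d.-homog -> d != e -> phi p = 0.
Proof.
move=> hp de; rewrite [p]mpolyE raddf_sum big_seq big1 // => m mp.
by rewrite /= linearZ /= phi_e ?mulr0 // (dhomog_mf hp mp).
Qed.

Lemma concentrated_pihomog p : phi p = phi (pihomog mdeg e p).
Proof.
rewrite {1}[p]mpolyE pihomogE !raddf_sum /= big_mkcond [LHS]/=.
rewrite [RHS]big_mkcond /=.
apply: eq_bigr => m _; case: ifP => // /negbT me.
by rewrite /= linearZ /= phi_e ?mulr0.
Qed.

(** A monomial of degree above [e] times [p] has all its terms in degrees above [e], where [phi]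
    vanishes. So finitely many tests suffice. *)
Lemma annih_monomials p :
  (forall m : 'X_{1..n}, (mdeg m <= e)%N -> phi (p * 'X_[m]) = 0) ->
  annih phi p.
Proof.
move=> h q; rewrite [q]mpolyE mulr_sumr raddf_sum big1 // => m _.
rewrite /= -scalerAr linearZ /=; have [/h->|em] := leqP (mdeg m) e.
  by rewrite mulr0.
rewrite [p]mpolyE mulr_suml raddf_sum big1 ?mulr0 // => m' _.
rewrite /= -scalerAl linearZ -mpolyXD /= phi_e ?mulr0 // mdegD.
by apply: contraL em => /eqP<-; rewrite -leqNgt leq_addl.
Qed.

Lemma annihB p q : annih phi p -> annih phi q -> annih phi (p - q).
Proof. by move=> hp hq u; rewrite mulrBl raddfB /= hp hq subrr. Qed.

Lemma annihD p q : annih phi p -> annih phi q -> annih phi (p + q).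
Proof. by move=> hp hq u; rewrite mulrDl raddfD /= hp hq addr0. Qed.

Lemma annihM p q : annih phi p -> annih phi (p * q).
Proof. by move=> hp u; rewrite -mulrA. Qed.

Lemma annihMl p q : annih phi p -> annih phi (q * p).
Proof. by rewrite mulrC; apply: annihM. Qed.

Lemma annihZ c p : annih phi p -> annih phi (c *: p).
Proof. by move=> hp u; rewrite -scalerAl linearZ /= hp mulr0. Qed.

Lemma annih_high d p : p \is d.-homog -> (e < d)%N -> annih phi p.
Proof.
move=> hp ed; apply: annih_monomials => m me.
apply: (@concentrated_homog (d + mdeg m)); last by lia.
by apply: dhomogM => //; rewrite dhomogX.
Qed.

(** Against a monomial of degree [e - d] only the degree [d] component of [p] contributes, so it
    pairs as [p] does; against other degrees it pairs to zero. *)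
Lemma annih_pihomog d p : annih phi p -> annih phi (pihomog mdeg d p).
Proof.
move=> hp; apply: annih_monomials => m me.
have [de|de] := eqVneq (d + mdeg m)%N e; last first.
  apply: concentrated_homog de; apply: dhomogM; first exact: pihomogP.
  by rewrite dhomogX.
rewrite -(hp 'X_[m]).
have -> : phi (p * 'X_[m]) =
    \sum_(d' < msize p) phi (pihomog mdeg d' p * 'X_[m]).
  by rewrite {1}[p]pihomogK mulr_suml raddf_sum.
have h0 d' : d' != d -> phi (pihomog mdeg d' p * 'X_[m]) = 0.
  move=> dd; apply: (@concentrated_homog (d' + mdeg m)).
    by apply: dhomogM; [apply: pihomogP|rewrite dhomogX].
  by rewrite -de eqn_add2r.
have [ds|sd] := ltnP d (msize p).
  by rewrite (bigD1 (Ordinal ds)) //= big1 ?addr0 // => d' /h0.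
rewrite big1 => [|d' _]; last first.
  by apply: h0; rewrite neq_ltn (leq_trans (ltn_ord d') sd).
suff ->: pihomog mdeg d p = 0 by rewrite mul0r raddf0.
rewrite pihomogE big_seq_cond big1 // => m' /andP[/msize_mdeg_lt ms /eqP dm].
by move: ms; rewrite dm ltnNge sd.
Qed.

End OneForm.

Section Catalecticant.
Variables (n : nat) (phi : {scalar {mpoly k[n]}}).
Hypothesis phi_e : concentrated phi.
Implicit Types p q : {mpoly k[n]}.
Local Notation T := 'X_{1..n < e.+1}.
Local Notation mon a := (bmnm (enum_val a : T)).

(** A linear map to a finite-dimensional space whose kernel is the annihilator of [phi]. *)
Definition pairings p : 'rV[k]_#|{: T}| := \row_b phi (p * 'X_[mon b]).

Lemma pairings_is_linear : linear pairings.
Proof.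
move=> c p q; apply/rowP => b; rewrite !mxE mulrDl raddfD /= -scalerAl.
by rewrite linearZ.
Qed.

HB.instance Definition _ := GRing.isLinear.Build _ _ _ _ _ pairings_is_linear.

Lemma pairings_eq0 p : reflect (annih phi p) (pairings p == 0).
Proof.
apply: (iffP eqP) => [p0|p0]; last by apply/rowP => b; rewrite !mxE p0.
apply: annih_monomials => // m me; rewrite -ltnS in me.
have := congr1 (fun v : 'rV_ _ => v 0 (enum_rank (BMultinom me))) p0.
by rewrite !mxE enum_rankK.
Qed.

(** Rows outside [S] are zeroed rather than dropped, so all these matrices share one type. The row
    space is the image under [pairings] of the polynomials supported in [S], so the rank is their
    dimension modulo the annihilator. *)
Definition catalecticant (S : pred 'X_{1..n}) : 'M[k]_#|{: T}| :=
  \matrix_(a, b) ((S (mon a))%:R * phi ('X_[mon a] * 'X_[mon b])).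

Lemma row_catalecticant (S : pred 'X_{1..n}) a :
  row a (catalecticant S) = (S (mon a))%:R *: pairings 'X_[mon a].
Proof. by apply/rowP => b; rewrite !mxE. Qed.

Lemma pairings_sub S p :
  all S (msupp p) -> (pairings p <= catalecticant S)%MS.
Proof.
move=> /allP Sp; rewrite [p]mpolyE raddf_sum big_seq; apply: summx_sub => m mp.
rewrite /= linearZ /=; apply: scalemx_sub; have [me|em] := leqP (mdeg m) e.
  rewrite -ltnS in me.
  have := row_catalecticant S (enum_rank (BMultinom me)).
  by rewrite enum_rankK /= Sp // scale1r => <-; apply: row_sub.
have /pairings_eq0/eqP-> : annih phi 'X_[m].
  by apply: annih_high em; rewrite // dhomogX.
exact: sub0mx.
Qed.

Lemma sub_pairings S v : (v <= catalecticant S)%MS ->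
  exists2 p, all S (msupp p) & pairings p = v.
Proof.
case/submxP => D ->.
pose p := \sum_a ((S (mon a))%:R * D 0 a) *: 'X_[mon a] : {mpoly k[n]}.
exists p.
  apply/allP => m; apply: contraLR => Sm; rewrite mcoeff_msupp negbK raddf_sum.
  rewrite big1 //= => a _; rewrite mcoeffZ mcoeffX.
  have [ma|] := eqP; last by rewrite mulr0.
  by rewrite ma (negPf Sm) !mul0r.
rewrite mulmx_sum_row raddf_sum; apply: eq_bigr => a _.
by rewrite /= linearZ /= row_catalecticant scalerA mulrC.
Qed.

Lemma indep_le_rank S d (p : 'I_d -> {mpoly k[n]}) :
    (forall i, all S (msupp (p i))) ->
    (forall c : 'rV_d, annih phi (\sum_i c 0 i *: p i) -> c = 0) ->
  (d <= \rank (catalecticant S))%N.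
Proof.
move=> Sp indep; pose P : 'M_(d, _) := \matrix_i pairings (p i).
have <- : \rank P = d.
  apply/eqP; apply: inj_row_free => c cP.
  apply: indep; apply/pairings_eq0/eqP.
  rewrite raddf_sum -[RHS]cP mulmx_sum_row.
  by apply: eq_bigr => i _; rewrite /= linearZ rowK.
by apply: mxrankS; apply/row_subP => i; rewrite rowK pairings_sub.
Qed.

Lemma rank_le_span S d (p : 'I_d -> {mpoly k[n]}) :
    (forall q, all S (msupp q) ->
       exists c : 'rV_d, annih phi (q - \sum_i c 0 i *: p i)) ->
  (\rank (catalecticant S) <= d)%N.
Proof.
move=> span; pose P : 'M_(d, _) := \matrix_i pairings (p i).
apply: leq_trans (rank_leq_row P); apply: mxrankS; apply/row_subP => a.
have [q Sq <-] := sub_pairings (row_sub a (catalecticant S)).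
have [c /pairings_eq0] := span q Sq; rewrite raddfB /= subr_eq0 => /eqP->.
apply/submxP; exists c; rewrite raddf_sum mulmx_sum_row.
by apply: eq_bigr => i _; rewrite /= linearZ rowK.
Qed.

(** A basis of the row space lifts through [pairings] to polynomials supported in [S]. *)
Lemma catalecticant_basis S :
  exists p : 'I_(\rank (catalecticant S)) -> {mpoly k[n]},
    [/\ forall i, all S (msupp (p i)),
        forall c : 'rV_(\rank (catalecticant S)),
          annih phi (\sum_i c 0 i *: p i) -> c = 0
      & forall q, all S (msupp q) ->
        exists c : 'rV_(\rank (catalecticant S)),
          annih phi (q - \sum_i c 0 i *: p i)].
Proof.
set C := catalecticant S; pose B := row_base C.
have Bp i : exists p, all S (msupp p) && (pairings p == row i B).
  have [|p Sp pB] := @sub_pairings S (row i B).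
    by rewrite -[X in (_ <= X)%MS]/C -(eq_row_base C) row_sub.
  by exists p; rewrite Sp pB eqxx.
pose p i := xchoose (Bp i).
have Sp i : all S (msupp (p i)) by case/andP: (xchooseP (Bp i)).
have pE (c : 'rV_(\rank C)) : pairings (\sum_i c 0 i *: p i) = c *m B.
  rewrite raddf_sum mulmx_sum_row; apply: eq_bigr => i _.
  by rewrite /= linearZ; case/andP: (xchooseP (Bp i)) => _ /eqP/= ->.
exists p; split=> // [c /pairings_eq0|q Sq].
  rewrite pE => /eqP cB; apply: (row_free_inj (row_base_free C)).
  by rewrite /= mul0mx.
have : (pairings q <= B)%MS by rewrite eq_row_base pairings_sub.
case/submxP => c qc; exists c; apply/pairings_eq0.
by rewrite raddfB /= pE qc subrr.
Qed.

End Catalecticant.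
End Forms.

(** * The Hilbert function of a form *)

Section HilbertFunctions.
Variables (k : fieldType) (e : nat).

Definition hilb n (phi : {scalar {mpoly k[n]}}) (j : nat) : nat :=
  \rank (catalecticant e phi [pred m | mdeg m == j]).

Section OneForm.
Variables (n : nat) (phi : {scalar {mpoly k[n]}}).
Hypothesis phi_e : concentrated e phi.
Implicit Types p q : {mpoly k[n]}.

Lemma indep_le_hilb j d (p : 'I_d -> {mpoly k[n]}) :
    (forall i, p i \is j.-homog) ->
    (forall c : 'rV_d, annih phi (\sum_i c 0 i *: p i) -> c = 0) ->
  (d <= hilb phi j)%N.
Proof. exact: indep_le_rank. Qed.

Lemma hilb_le_span j d (p : 'I_d -> {mpoly k[n]}) :
    (forall q, q \is j.-homog ->
       exists c : 'rV_d, annih phi (q - \sum_i c 0 i *: p i)) ->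
  (hilb phi j <= d)%N.
Proof. exact: rank_le_span. Qed.

Lemma hilb_basis j : exists p : 'I_(hilb phi j) -> {mpoly k[n]},
    [/\ forall i, p i \is j.-homog,
        forall c : 'rV_(hilb phi j),
          annih phi (\sum_i c 0 i *: p i) -> c = 0
      & forall q, q \is j.-homog -> exists c : 'rV_(hilb phi j),
          annih phi (q - \sum_i c 0 i *: p i)].
Proof. exact: (catalecticant_basis phi_e). Qed.

(** Only entries of total degree [e] survive, so the matrices for [j] and [e - j] are transposes of
    each other. *)
Lemma hilb_sym j : (j <= e)%N -> hilb phi (e - j) = hilb phi j.
Proof.
move=> je; rewrite /hilb -[RHS]mxrank_tr; congr (\rank _).
apply/matrixP => a b; rewrite !mxE /= ['X_[bmnm (enum_val b)] * _]mulrC.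
rewrite -mpolyXD; set u := (_ + _)%MM.
have [ue|/phi_e->] := eqVneq (mdeg u) e; last by rewrite !mulr0.
congr (_%:R * _); move: je ue; rewrite mdegD; lia.
Qed.

Lemma hilb0 p : phi p != 0 -> hilb phi 0 = 1%N.
Proof.
move=> phip; apply/eqP; rewrite eqn_leq; apply/andP; split.
  apply: (@hilb_le_span 0 1 (fun _ => 1)) => q hq; exists (\row__ q@_0).
  suff ->: q = q@_0 *: 1.
    rewrite big_ord1 mxE mcoeffZ mcoeff1 eqxx mulr1 subrr => u.
    by rewrite mul0r raddf0.
  apply/mpolyP => m; rewrite mcoeffZ mcoeff1 eq_sym.
  case: eqP => [->|/eqP m0]; first by rewrite mulr1.
  by rewrite mulr0 (dhomog_nemf_coeff hq) //= mdeg_eq0 eq_sym.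
apply: (@indep_le_hilb 0 1 (fun _ => 1)) => [_|c]; first exact: dhomog1.
move=> /(_ p)/eqP; rewrite big_ord1 -scalerAl mul1r linearZ /=.
rewrite mulf_eq0 (negPf phip) orbF => /eqP c0.
by apply/rowP => i; rewrite ord1 c0 mxE.
Qed.

Lemma hilb1 : nondegenerate phi -> hilb phi 1 = n.
Proof.
move=> nd; apply/eqP; rewrite eqn_leq; apply/andP; split.
  apply: (@hilb_le_span 1 n (fun i => 'X_i)) => q hq.
  exists (\row_i q@_U_(i)); rewrite {1}(linear_formE hq).
  rewrite -sumrB big1 => [|i _]; last by rewrite mxE subrr.
  by move=> u; rewrite mul0r raddf0.
apply: (@indep_le_hilb 1 n (fun i => 'X_i)) => [i|c].
  by rewrite dhomogX /= mdeg1.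
move=> /nd c0; apply/rowP => i; rewrite mxE -(coef_sum_linear_form _ i).
by rewrite c0 ?mcoeff0 // sum_linear_form.
Qed.

End OneForm.

(** The composite is [phi] restricted to the subalgebra generated by [w]. Independence there
    persists after substitution, since annihilating [phi] demands more test polynomials than
    annihilating the restriction. *)
Lemma hilb_comp n r (phi : {scalar {mpoly k[n]}})
    (w : r.-tuple {mpoly k[n]}) j :
    concentrated e phi -> concentrated e (phi \o comp_mpoly w) ->
    (forall i, tnth w i \is 1.-homog) ->
  (hilb (phi \o comp_mpoly w) j <= hilb phi j)%N.
Proof.
move=> phi_e phiw_e hw; have [p [hp indep _]] := hilb_basis phiw_e j.
apply: (@indep_le_hilb _ phi phi_e j _ (fun i => p i \mPo w)) => [i|c ann].
  exact: homog_comp_mpoly.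
apply: indep => q /=; rewrite rmorphM /= raddf_sum /=.
by under eq_bigr do rewrite comp_mpolyZ.
Qed.

Lemma concentrated_comp n r (phi : {scalar {mpoly k[n]}})
    (w : r.-tuple {mpoly k[n]}) :
    concentrated e phi -> (forall i, tnth w i \is 1.-homog) ->
  concentrated e (phi \o comp_mpoly w).
Proof.
move=> phi_e hw m me /=; apply: (concentrated_homog phi_e) me.
by apply: homog_comp_mpoly => //; rewrite dhomogX.
Qed.

End HilbertFunctions.

(** * Polarization in characteristic zero *)

Section Restriction.
Variable k : fieldType.
Hypothesis char0 : [pchar k] =i pred0.

Lemma polynomial_coef_eq0 d (F : nat -> k) :
  (forall t, \sum_(i < d) F i * t ^+ i = 0) -> forall i, (i < d)%N -> F i = 0.
Proof.
move=> F0 i id.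
have /(congr1 (fun p : {poly k} => p`_i)) : \poly_(i < d) F i = 0.
  by apply: polyfun_eq0 => // t; rewrite horner_poly F0.
by rewrite coef_poly id coef0.
Qed.

(** Induction on [zs]: replace [z] by [z + t *: y] in the power of exponent [a.+1]. The result
    vanishes for all [t], so the coefficient of [t] does too; it is [a.+1] times the wanted value,
    and [a.+1] is nonzero in [k]. *)
Lemma polarization n (phi : {scalar {mpoly k[n]}})
    (Z : {mpoly k[n]} -> Prop) (u : {mpoly k[n]}) :
    (forall y z t, Z y -> Z z -> Z (z + t *: y)) ->
    (forall z a, Z z -> (0 < a)%N -> phi (z ^+ a * u) = 0) ->
  forall zs z a, {in zs, forall y, Z y} -> Z z -> (0 < size zs + a)%N ->
    phi (\prod_(y <- zs) y * z ^+ a * u) = 0.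
Proof.
move=> ZD Z0; elim=> [|y zs IH] z a Zzs Zz az.
  by rewrite big_nil mul1r Z0.
have Zy : Z y by apply: Zzs; rewrite mem_head.
pose P := \prod_(y <- zs) y.
pose F i := 'C(a.+1, i)%:R * phi (P * (z ^+ (a.+1 - i) * y ^+ i) * u).
have /polynomial_coef_eq0/(_ 1%N isT) :
    forall t, \sum_(i < a.+2) F i * t ^+ i = 0.
  move=> t; rewrite -[RHS](IH (z + t *: y) a.+1) ?addnS //; first last.
  - exact: ZD.
  - by move=> v vzs; apply: Zzs; rewrite inE vzs orbT.
  rewrite -/P exprDn mulr_sumr mulr_suml raddf_sum.
  apply: eq_bigr => i _; rewrite /F exprZn /= !(mulrnAr, mulrnAl) raddfMn /=.
  rewrite -!scalerAr -scalerAl linearZ /=.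
  by rewrite mul1r mulrC.
move=> F1; have /eqP : a.+1%:R * phi (P * (z ^+ a * y) * u) = 0.
  by rewrite -F1 /F bin1 subn1 expr1.
rewrite mulf_eq0 ((pcharf0P _).1 char0) /= => /eqP<-.
by rewrite big_cons -/P; congr (phi (_ * u)); rewrite -mulrA mulrC -mulrA.
Qed.

End Restriction.

(** * Nondegenerate restriction to fewer variables *)

Section Nondegenerate.
Variable k : fieldType.
Hypothesis char0 : [pchar k] =i pred0.

Lemma comp_mpolyX_tnth n r (w : n.-tuple {mpoly k[r]}) i :
  'X_i \mPo w = tnth w i.
Proof. by rewrite comp_mpolyXU -tnth_nth. Qed.

Lemma comp_linear_form n r (w : n.-tuple {mpoly k[r]}) (p : {mpoly k[n]}) :
  p \is 1.-homog -> p \mPo w = \sum_(i < n) p@_U_(i) *: tnth w i.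
Proof.
move=> hp; rewrite {1}(linear_formE hp) raddf_sum /=.
by apply: eq_bigr => i _; rewrite comp_mpolyZ comp_mpolyX_tnth.
Qed.

Section Extend.
Variables (n r : nat) (phi : {scalar {mpoly k[n]}}) (w : r.-tuple {mpoly k[n]}).
Hypothesis w1 : forall i, tnth w i \is 1.-homog.
Hypothesis phi_nd : nondegenerate phi.
Hypothesis phiw_nd : nondegenerate (phi \o comp_mpoly w).

(** Renaming that leaves variable 0 free for the new form [z]. *)
Let lift_vars : r.-tuple {mpoly k[r.+1]} := [tuple 'X_(lift ord0 i) | i < r].

Let comp_lift z q : (q \mPo lift_vars) \mPo [tuple of z :: w] = q \mPo w.
Proof.
rewrite comp_mpolyA; congr (_ \mPo _); apply: eq_from_tnth => i.
by rewrite !tnth_mktuple comp_mpolyX_tnth tnthS.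
Qed.

(** The space Z of linear forms orthogonal to k[W], where W is spanned by [w]. *)
Let perp (z : {mpoly k[n]}) :=
  z \is 1.-homog /\ forall q, phi (z * (q \mPo w)) = 0.

Let perp_eq0 v : v \is 1.-homog -> perp (v \mPo w) -> v = 0.
Proof.
move=> hv [_ vp]; apply: phiw_nd => // q.
by rewrite /= rmorphM /= vp.
Qed.

Section Maximal.
Hypothesis maximal : forall z, z \is 1.-homog ->
  ~ nondegenerate (phi \o comp_mpoly [tuple of z :: w]).

(** By maximality some nonzero linear form in [z] and [w] annihilates the restriction to k[z, W]. It
    must involve [z], and is scaled to have coefficient one there. *)
Let degenerate_ext (z : {mpoly k[n]}) : z \is 1.-homog ->
  exists2 v : {mpoly k[r]}, v \is 1.-homog &
  forall q, phi ((z - (v \mPo w)) * (q \mPo [tuple of z :: w])) = 0.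
Proof.
move=> hz; apply: NNPP => no; apply: (maximal hz) => p hp ann.
pose p1 : {mpoly k[r]} := \sum_(i < r) p@_U_(lift ord0 i) *: 'X_i.
have pE : p \mPo [tuple of z :: w] = p@_U_(ord0) *: z + (p1 \mPo w).
  rewrite comp_linear_form // big_ord_recl tnth0; congr (_ + _).
  rewrite comp_linear_form; last exact: sum_linear_form.
  by apply: eq_bigr => i _; rewrite tnthS coef_sum_linear_form.
have annE q :
    phi ((p@_U_(ord0) *: z + (p1 \mPo w)) * (q \mPo [tuple of z :: w])) = 0.
  by have := ann q; rewrite /= rmorphM /= pE.
(* A nonzero coefficient of [z] would produce the excluded [v]. A zero one leaves [p1] annihilating
   the restriction to k[W], so [p1], and with it [p], is zero. *)
have [c0|c0] := eqVneq (p@_U_(ord0)) 0; last first.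
  case: no; exists (- (p@_U_(ord0))^-1 *: p1).
    by rewrite rpredZ // sum_linear_form.
  move=> q; apply: (mulfI c0); rewrite mulr0 -[RHS](annE q) -linearZ /=.
  rewrite scalerAl comp_mpolyZ scaleNr opprK scalerDr scalerA.
  by rewrite mulfV // scale1r.
have p10 : p1 = 0.
  apply: phiw_nd; first exact: sum_linear_form.
  move=> q; rewrite /= rmorphM /= -(comp_lift z q).
  by rewrite -[RHS](annE (q \mPo lift_vars)) c0 scale0r add0r.
rewrite (linear_formE hp) big1 // => i _.
have [->|[j ->]] : i = ord0 \/ exists j, i = lift ord0 j.
- by case: (unliftP ord0 i) => [j|] ->; [right; exists j|left].
- by rewrite c0 scale0r.
- by have := coef_sum_linear_form (fun i => p@_U_(lift ord0 i)) j;
     rewrite -/p1 p10 mcoeff0 => <-; rewrite scale0r.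
Qed.

Let perp_part (z : {mpoly k[n]}) : z \is 1.-homog ->
  exists2 v : {mpoly k[r]}, v \is 1.-homog & perp (z - (v \mPo w)).
Proof.
move=> hz; have [v hv vp] := degenerate_ext hz; exists v => //; split.
  by rewrite rpredB // homog_comp_mpoly.
by move=> q; rewrite -(comp_lift z q).
Qed.

(** For [z] in Z the form [v] given by [degenerate_ext] maps into both W and Z, hence is zero. So
    [z] itself annihilates k[z, W], which contains the remaining factors. *)
Let perp_pow z a q : perp z -> (0 < a)%N -> phi (z ^+ a * (q \mPo w)) = 0.
Proof.
case: a => // a zp _; have [hz zw] := zp; have [v hv vp] := degenerate_ext hz.
have v0 : v = 0.
  apply: perp_eq0 => //; split=> [|u]; first exact: homog_comp_mpoly.
  have := vp (u \mPo lift_vars); rewrite comp_lift mulrBl raddfB /= zw.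
  by rewrite sub0r => /eqP; rewrite oppr_eq0 => /eqP.
have := vp ('X_ord0 ^+ a * (q \mPo lift_vars)).
rewrite rmorphM rmorphXn /= comp_mpolyX_tnth tnth0 comp_lift v0 raddf0 subr0.
by rewrite mulrA -exprS.
Qed.

Let perp_prod zs q : {in zs, forall z, perp z} -> (0 < size zs)%N ->
  phi (\prod_(z <- zs) z * (q \mPo w)) = 0.
Proof.
move=> hzs zs0; have perp0 : perp 0.
  by split=> [|u]; rewrite ?rpred0 // mul0r raddf0.
have := polarization char0 (Z := perp) (u := q \mPo w) _ _ hzs perp0 (a := 0).
rewrite expr0 mulr1 addn0; apply=> // [y z t [hy yp] [hz zp]|z a zp a0].
  split=> [|u]; first by rewrite rpredD // rpredZ.
  by rewrite mulrDl raddfD /= -scalerAl linearZ /= zp yp mulr0 addr0.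
exact: perp_pow.
Qed.

(** Quantifying over [zs] and [q] lets an induction on the factors of [p] move each one into Z or
    into k[W]. *)
Let perp_kills p := forall zs q, {in zs, forall z, perp z} -> (0 < size zs)%N ->
  phi (\prod_(z <- zs) z * p * (q \mPo w)) = 0.

(** Split the variable along Z + W: the Z part joins [zs], the W part joins [q]. *)
Let perp_killsX i p : perp_kills p -> perp_kills ('X_i * p).
Proof.
move=> kp zs q hzs zs0.
have [|v hv vp] := @perp_part 'X_i; first by rewrite dhomogX /= mdeg1.
rewrite -['X_i](subrK (v \mPo w)) mulrDl mulrDr mulrDl raddfD /=.
have -> : phi (\prod_(z <- zs) z * (('X_i - (v \mPo w)) * p) * (q \mPo w)) = 0.
  have := kp (('X_i - (v \mPo w)) :: zs) q; rewrite big_cons.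
  rewrite [('X_i - _) * _]mulrC -[_ * _ * p]mulrA; apply=> // z.
  by rewrite inE => /orP[/eqP->|/hzs].
rewrite add0r -[RHS](kp zs (v * q) hzs zs0) rmorphM /=.
by congr (phi _); rewrite -!mulrA; congr (_ * _); rewrite mulrCA.
Qed.

(** All monomials satisfy [perp_kills], so [z] annihilates [phi]. *)
Let perp0 z : perp z -> z = 0.
Proof.
move=> zp; apply: phi_nd; first by case: zp.
move=> q; rewrite [q]mpolyE mulr_sumr raddf_sum big1 // => m _ /=.
rewrite -scalerAr linearZ /=.
suff : forall p, perp_kills p -> perp_kills ('X_[m] * p).
  move=> /(_ 1) k1; have := k1 _ [:: z] 1; rewrite big_seq1 mulr1 rmorph1 mulr1.
  move=> -> //; first by rewrite mulr0.
    by move=> zs u hzs zs0; rewrite mulr1 perp_prod.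
  by move=> y; rewrite inE => /eqP->.
rewrite mpolyXE_id.
apply: (big_ind (fun x => forall p, perp_kills p -> perp_kills (x * p))).
- by move=> p; rewrite mul1r.
- by move=> x y hx hy p kp; rewrite -mulrA; apply/hx/hy.
- move=> i _; elim: (m i) => [|a IH] p kp; first by rewrite mul1r.
  by rewrite exprS -mulrA; apply/perp_killsX/IH.
Qed.

(** As Z is zero, each variable is a combination of [w]. The coefficient matrices then factor the
    identity of size [n] through dimension [r]. *)
Lemma maximal_full : (n <= r)%N.
Proof.
have Xw i : exists v : {mpoly k[r]}, (v \is 1.-homog) && ('X_i == v \mPo w).
  have [|v hv vp] := @perp_part 'X_i; first by rewrite dhomogX /= mdeg1.
  by exists v; rewrite hv -subr_eq0; apply/eqP/perp0.
pose v i := xchoose (Xw i).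
pose A : 'M[k]_(n, r) := \matrix_(i, j) (v i)@_U_(j).
pose B : 'M[k]_(r, n) := \matrix_(j, l) (tnth w j)@_U_(l).
apply: (@mulmx1_min _ _ _ A B); apply/matrixP => i l; rewrite !mxE.
have /andP[vi /eqP Xi] := xchooseP (Xw i).
rewrite -(mcoeffXU k i l) Xi comp_linear_form // raddf_sum.
by apply: eq_bigr => j _; rewrite !mxE -mcoeffZ.
Qed.

End Maximal.

Lemma nondegenerate_extend : (r < n)%N -> exists2 z, z \is 1.-homog &
  nondegenerate (phi \o comp_mpoly [tuple of z :: w]).
Proof.
move=> rn; apply: NNPP => no; move: rn; rewrite ltnNge maximal_full //.
by move=> z hz nd; apply: no; exists z.
Qed.

End Extend.

Lemma nondegenerate_restrict n r (phi : {scalar {mpoly k[n]}}) :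
    nondegenerate phi -> (r <= n)%N ->
  exists w : r.-tuple {mpoly k[n]}, (forall i, tnth w i \is 1.-homog) /\
    nondegenerate (phi \o comp_mpoly w).
Proof.
move=> nd; elim: r => [|r IH] rn.
  exists [tuple]; split=> [[]//|p hp _].
  by rewrite (linear_formE hp) big_ord0.
have [w [w1 wnd]] := IH (ltnW rn).
have [z z1 znd] := nondegenerate_extend w1 nd wnd rn.
exists [tuple of z :: w]; split=> // i.
by case: (unliftP ord0 i) => [j|] ->; rewrite ?tnth0 ?tnthS.
Qed.

End Nondegenerate.

(** * A polynomial vanishing at all points is zero *)

Section PolynomialFunctions.
Variable k : fieldType.
Hypothesis char0 : [pchar k] =i pred0.

Lemma meval_muni n (p : {mpoly k[n.+1]}) (v : 'I_n.+1 -> k) :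
  p.@[v] =
  (map_poly (meval (fun i => v (widen_ord (leqnSn n) i))) (muni p)).[v ord_max].
Proof.
rewrite muniE raddf_sum horner_sum [LHS]mevalE; apply: eq_bigr => m _ /=.
rewrite map_polyZ map_polyXn hornerZ hornerXn /= mevalZ mevalX -mulrA.
by rewrite big_ord_recr /=; under [in RHS]eq_bigr do rewrite mnmE.
Qed.

Lemma mcoeff_muni n (p : {mpoly k[n.+1]}) (m : 'X_{1..n.+1}) :
  ((muni p)`_(m ord_max))@_[multinom m (widen_ord (leqnSn n) i) | i < n] = p@_m.
Proof.
rewrite muniE coef_sum raddf_sum [in RHS](mpolyE p) raddf_sum.
apply: eq_bigr => m' _ /=; rewrite coefZ coefXn !mcoeffZ mcoeffX.
have [->|mm'] := eqVneq m' m.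
  by rewrite eqxx mulr1 mcoeffZ mcoeffX eqxx mulr1.
rewrite mulr0; case: eqP => [mo|_]; last by rewrite mulr0 mcoeff0.
rewrite mulr1 mcoeffZ mcoeffX; case: eqP => [mw|]; last by rewrite mulr0.
case/eqP: mm'; apply/mnmP => i.
case: (unliftP ord_max i) => [j ->|->//].
have -> : lift ord_max j = widen_ord (leqnSn n) j.
  by apply: val_inj; exact: lift_max.
by have := congr1 (fun u : 'X_{1..n} => u j) mw; rewrite !mnmE.
Qed.

(** Fixing all but the last coordinate leaves a univariate polynomial with zero values, hence zero;
    induction then applies to the coefficients of [muni p]. *)
Lemma meval_eq0 n (p : {mpoly k[n]}) : (forall v, p.@[v] = 0) -> p = 0.
Proof.
elim: n => [|n IH] in p *.
  move=> p0; apply/mpolyP => m; rewrite mcoeff0.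
  have m0 (u : 'X_{1..0}) : u = 0%MM by apply/mnmP => -[].
  have := p0 (fun _ => 0); rewrite (nvar0_mpolyC p) mevalC => ->.
  by rewrite mcoeff0.
move=> p0; apply/mpolyP => m; rewrite -mcoeff_muni mcoeff0.
suff -> : (muni p)`_(m ord_max) = 0 by rewrite mcoeff0.
apply: IH => v; rewrite -coef_map /=.
suff -> : map_poly (meval v) (muni p) = 0 by rewrite coef0.
apply: polyfun_eq0 => // t.
pose v' (i : 'I_n.+1) := if unlift ord_max i is Some j then v j else t.
have := p0 v'; rewrite meval_muni {2}/v' unlift_none => <-.
congr (_.[_]); apply: eq_map_poly => q; apply: meval_eq => i /=; rewrite /v'.
have -> : widen_ord (leqnSn n) i = lift ord_max i.
  by apply: val_inj; apply/esym; exact: lift_max.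
by rewrite liftK.
Qed.

End PolynomialFunctions.

(** * Adding a power of a linear form raises the quadric rank by one *)

Section Raise.
Variables (k : fieldType) (e : nat).
Hypothesis e_ge4 : (4 <= e)%N.

(* Evaluation at [v] in degree [e] is the functional of the [e]-th divided power
   of the linear form dual to the point [v]. *)
Definition add_power n (phi : {scalar {mpoly k[n]}}) (v : 'I_n -> k) :
    {scalar {mpoly k[n]}} :=
  phi \+ (meval v \o pihomog mdeg e).

Section AddPower.
Variables (n : nat) (phi : {scalar {mpoly k[n]}}) (p0 : {mpoly k[n]}).
Variable v : 'I_n -> k.
Hypotheses (phi_e : concentrated e phi) (phi_nd : nondegenerate phi).
Hypotheses (p0_2 : p0 \is 2.-homog) (p0_ann : annih phi p0).
Hypothesis p0v : p0.@[v] != 0.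
Local Notation psi := (add_power phi v).

Lemma add_power_concentrated : concentrated e psi.
Proof.
by move=> m me; rewrite /= phi_e // pihomogX (negPf me) meval0 addr0.
Qed.

Let psiM j (p : {mpoly k[n]}) q l : p \is j.-homog -> q \is l.-homog ->
  (j + l)%N = e -> psi (p * q) = phi (p * q) + p.@[v] * q.@[v].
Proof.
move=> hp hq jl; rewrite /= pihomog_dE ?mevalM //.
by rewrite -jl dhomogM.
Qed.

Let v_neq0 : exists i, v i != 0.
Proof.
have [/existsP//|] := boolP [exists i, v i != 0].
rewrite negb_exists => /forallP v0.
case/eqP: p0v; rewrite mevalE big_seq big1 // => m mp.
have [/forallP m0|] := boolP [forall i, m i == 0%N].
  have : mdeg m = 2 := dhomog_mf p0_2 mp.
  by rewrite mdegE big1 // => i _; apply/eqP.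
rewrite negb_forall => /existsP[i mi].
by rewrite (bigD1 i) //= (eqP (negPn (v0 i))) expr0n (negPf mi) mul0r mulr0.
Qed.

(** In complementary degrees [psi] pairs [p] and [q] to [phi (p * q)] plus the product of their
    values at [v]. Multiples of [p0] kill the first summand and isolate the value of [p]. *)
Lemma annih_add_power j (p : {mpoly k[n]}) : p \is j.-homog -> (j <= 2)%N ->
  annih psi p <-> annih phi p /\ p.@[v] = 0.
Proof.
move=> hp j2.
have step : p.@[v] = 0 ->
    forall m : 'X_{1..n}, psi (p * 'X_[m]) = phi (p * 'X_[m]).
  move=> pv m; have hm : ('X_[m] : {mpoly k[n]}) \is (mdeg m).-homog.
    by rewrite dhomogX.
  have [jm|jm] := eqVneq (j + mdeg m)%N e.
    by rewrite (psiM hp hm) // pv mul0r addr0.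
  have hpm := dhomogM hp hm.
  by rewrite /= (pihomog_ne0 jm hpm) meval0 addr0.
split=> [ann|[ann pv]]; last first.
  apply: (annih_monomials add_power_concentrated) => m _.
  by rewrite step.
have pv : p.@[v] = 0.
  have [i vi] := v_neq0.
  (* A test polynomial of degree exactly [e - j], nonzero at [v]; the exponent is a true difference
     because [j <= 2] and [4 <= e]. *)
  have hq : p0 * 'X_i ^+ (e - 2 - j) \is (2 + 1 * (e - 2 - j)).-homog.
    by apply: dhomogM => //; apply: dhomogMn; rewrite dhomogX /= mdeg1.
  have := ann (p0 * 'X_i ^+ (e - 2 - j)); rewrite (psiM hp hq); last by lia.
  rewrite mulrCA p0_ann add0r mevalM rmorphXn /= mevalXU => /eqP.
  by rewrite !mulf_eq0 (negPf p0v) expf_eq0 (negPf vi) andbF !orbF => /eqP.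
split=> //; apply: (annih_monomials phi_e) => m _.
by rewrite -step.
Qed.

Lemma add_power_nondegenerate : nondegenerate psi.
Proof.
by move=> p hp /(annih_add_power hp isT)[/(phi_nd hp)].
Qed.

(** The quadrics annihilating [psi] are those annihilating [phi] that vanish at [v], a hyperplane
    missing [p0]. So [p0] together with a basis for [phi] is a basis for [psi]. *)
Lemma hilb_add_power : hilb e psi 2 = (hilb e phi 2).+1.
Proof.
have [p [hp indep span]] := hilb_basis phi_e 2.
have psi_e := add_power_concentrated.
pose P i := if unlift ord0 i is Some j then p j else p0.
have PE (c : 'rV_(hilb e phi 2).+1) : \sum_i c 0 i *: P i =
    c 0 ord0 *: p0 + \sum_i c 0 (lift ord0 i) *: p i.
  rewrite big_ord_recl {1}/P unlift_none; congr (_ + _).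
  by apply: eq_bigr => i _; rewrite /P liftK.
have hP i : P i \is 2.-homog by rewrite /P; case: unlift.
have hS (c : 'rV_(hilb e phi 2).+1) : \sum_i c 0 i *: P i \is 2.-homog.
  by apply: rpred_sum => i _; rewrite rpredZ.
apply/eqP; rewrite eqn_leq; apply/andP; split; last first.
  apply: (indep_le_hilb psi_e hP) => c /(annih_add_power (hS c) isT)[].
  rewrite PE => ann.
  have /indep c_lift : annih phi (\sum_i (\row_i c 0 (lift ord0 i)) 0 i *: p i).
    under eq_bigr do rewrite mxE.
    have := annihB ann (annihZ (c 0 ord0) p0_ann).
    by rewrite addrAC subrr add0r.
  have cl i : c 0 (lift ord0 i) = 0.
    by have := congr1 (fun u : 'rV_ _ => u 0 i) c_lift; rewrite !mxE.
  rewrite big1 => [|i _]; last by rewrite cl scale0r.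
  rewrite addr0 mevalZ => /eqP; rewrite mulf_eq0 (negPf p0v) orbF => /eqP c0.
  apply/rowP => i; rewrite [RHS]mxE.
  by case: (unliftP ord0 i) => [j|] ->; rewrite ?cl ?c0.
apply: (@hilb_le_span _ _ _ _ psi_e _ _ P) => q hq.
have [c ann] := span q hq; set u := q - _ in ann.
(* The multiple of [p0] that makes the remainder vanish at [v]. *)
pose c0 := u.@[v] / p0.@[v].
pose d : 'rV_(hilb e phi 2).+1 :=
  \row_i (if unlift ord0 i is Some j then c 0 j else c0).
have dE : q - \sum_i d 0 i *: P i = u - c0 *: p0.
  rewrite PE mxE unlift_none /u opprD addrA addrAC; congr (_ - _ - _).
  by apply: eq_bigr => i _; rewrite mxE liftK.
exists d; apply/(annih_add_power (j := 2)) => //.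
  exact: (rpredB hq (hS d)).
rewrite dE; split; first by apply: annihB => //; apply: annihZ.
by rewrite mevalB mevalZ /c0 mulfVK // subrr.
Qed.

End AddPower.
End Raise.

(** * Reaching every intermediate quadric rank *)

Section RaiseTo.
Variables (k : fieldType) (e : nat).
Hypothesis char0 : [pchar k] =i pred0.
Hypothesis e_ge4 : (4 <= e)%N.

Definition widen_vars n' n (le_n : (n' <= n)%N) : n'.-tuple {mpoly k[n]} :=
  [tuple 'X_(widen_ord le_n i) | i < n'].

(** Setting the extra variables to zero is a left inverse. *)
Lemma comp_widen_vars_inj n' n (le_n : (n' <= n)%N) :
  injective (comp_mpoly (widen_vars le_n)).
Proof.
pose u : n.-tuple {mpoly k[n']} :=
  [tuple (if insub (val j) is Some i then 'X_i else 0) | j < n].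
apply: (can_inj (g := comp_mpoly u)) => p; rewrite comp_mpolyA.
rewrite -[RHS]comp_mpoly_id; congr (_ \mPo _); apply: eq_from_tnth => i.
by rewrite !tnth_mktuple comp_mpolyX_tnth tnth_mktuple valK.
Qed.

(** If no nonzero quadric annihilated [phi], quadrics independent modulo the annihilator of [psi]
    would stay independent modulo that of [phi] after inclusion into [n] variables. *)
Lemma quadric_annih n n' (phi : {scalar {mpoly k[n]}})
    (psi : {scalar {mpoly k[n']}}) :
    concentrated e phi -> concentrated e psi -> (n' <= n)%N ->
    (hilb e phi 2 < hilb e psi 2)%N ->
  exists p, [/\ p \is 2.-homog, annih phi p & p != 0].
Proof.
move=> phi_e psi_e le_n lt_h; apply: NNPP => no; move: lt_h.
rewrite ltnNge; case/negP; have [p [hp indep _]] := hilb_basis psi_e 2.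
have hw i : tnth (widen_vars le_n) i \is 1.-homog.
  by rewrite tnth_mktuple dhomogX /= mdeg1.
have hP i : p i \mPo widen_vars le_n \is 2.-homog by rewrite homog_comp_mpoly.
apply: (indep_le_hilb phi_e hP) => c ann; apply: indep => q.
suff -> : \sum_i c 0 i *: p i = 0 by rewrite mul0r raddf0.
apply: (@comp_widen_vars_inj _ _ le_n); rewrite raddf0 raddf_sum /=.
under eq_bigr do rewrite comp_mpolyZ.
apply/eqP; apply: contraPT ann => s0 ann; apply: no.
exists (\sum_i c 0 i *: (p i \mPo widen_vars le_n)); split => //.
by apply: rpred_sum => i _; apply: rpredZ; apply: hP.
Qed.

(** One power is added at a time; [psi] only certifies that an annihilating quadric is still
    available. *)
Lemma raise_hilb2 n n' (phi : {scalar {mpoly k[n]}})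
    (psi : {scalar {mpoly k[n']}}) b :
    concentrated e phi -> nondegenerate phi -> concentrated e psi ->
    (n' <= n)%N -> (hilb e phi 2 <= b <= hilb e psi 2)%N ->
  exists chi : {scalar {mpoly k[n]}},
    [/\ concentrated e chi, nondegenerate chi & hilb e chi 2 = b].
Proof.
move=> phi_e phi_nd psi_e le_n /andP[].
elim: b => [|b IH] phi_b b_psi.
  by exists phi; split=> //; apply/eqP; rewrite -leqn0.
move: phi_b; rewrite leq_eqVlt => /orP[/eqP phi_b|phi_b].
  by exists phi; split.
have [chi [chi_e chi_nd chi_b]] := IH phi_b (ltnW b_psi).
have [|p0 [p0_2 p0_ann p0_neq0]] := quadric_annih chi_e psi_e le_n.
  by rewrite chi_b.
have [v p0v] : exists v, p0.@[v] != 0.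
  apply: NNPP => no; case/eqP: p0_neq0; apply: meval_eq0 => // v.
  by apply/eqP; apply: contraPT no => p0v []; exists v.
exists (add_power e chi v); split.
- exact: add_power_concentrated.
- exact: (add_power_nondegenerate e_ge4 chi_e chi_nd p0_2 p0_ann p0v).
- by rewrite (hilb_add_power e_ge4 chi_e p0_2 p0_ann p0v) chi_b.
Qed.

End RaiseTo.

(** * Dimensions in the quotient algebra, computed on representatives *)

Section QuotientAlgebra.
Variables (k : fieldType) (r : nat) (I : idealr {mpoly k[r]}).
Local Notation cls := (quot_class I).

Lemma quot_class_eq0 p : (cls p == 0) = (p \in I).
Proof.
have -> : 0 = cls 0 by rewrite /quot_class raddf0.
by rewrite /quot_class -Quotient.idealrBE subr0.
Qed.

Lemma quot_class0 : cls 0 = 0.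
Proof. by apply/eqP; rewrite quot_class_eq0 idealr0. Qed.

Lemma quot_classZ c p : cls (c *: p) = c *: cls p.
Proof. by rewrite -mul_mpolyC quot_classM. Qed.

Lemma quot_classB p q : cls (p - q) = cls p - cls q.
Proof. by rewrite quot_classD -scaleN1r quot_classZ scaleN1r. Qed.

Lemma quot_class_comb d (c : 'I_d -> k) (p : 'I_d -> {mpoly k[r]}) :
  cls (\sum_i c i *: p i) = \sum_i c i *: cls (p i).
Proof.
rewrite (big_morph cls (@quot_classD _ _ _) quot_class0).
by apply: eq_bigr => i _; rewrite quot_classZ.
Qed.

Lemma quot_class_surj a : exists p, a = cls p.
Proof. by exists (repr a); rewrite /quot_class reprK. Qed.

Lemma is_dim_quotP (S : {mpoly k[r]} -> Prop) d : S 0 ->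
  is_dim (fun a => exists2 p, S p & a = cls p) d <->
  exists p : 'I_d -> {mpoly k[r]},
    [/\ forall i, S (p i),
        forall c : 'rV_d, \sum_i c 0 i *: p i \in I -> c = 0
      & forall q, S q -> exists c : 'rV_d, q - \sum_i c 0 i *: p i \in I].
Proof.
move=> S0; split=> [[b [/fin_all_exists2[p Sp bE] bU]]|[p [Sp indep span]]].
  exists p; split=> // [c|q Sq].
    rewrite -quot_class_eq0 quot_class_comb => /eqP c0.
    (* Independence is the uniqueness of the coordinates of zero. *)
    have [|c' [_ uniq]] := bU 0; first by exists 0; rewrite // quot_class0.
    rewrite -(uniq c); last first.
      by rewrite -[LHS]c0; apply: eq_bigr => i _; rewrite bE.
    by apply: uniq; rewrite big1 // => i _; rewrite mxE scale0r.
  have [|c [qE _]] := bU (cls q); first by exists q.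
  exists c; rewrite -quot_class_eq0 quot_classB quot_class_comb qE subr_eq0.
  by apply/eqP/eq_bigr => i _; rewrite bE.
exists (fun i => cls (p i)); split=> [i|_ [q Sq ->]]; first by exists (p i).
have [c cI] := span q Sq; exists c; split.
  by apply/eqP; rewrite -quot_class_comb -subr_eq0 -quot_classB quot_class_eq0.
move=> c' qE; apply/eqP; rewrite -subr_eq0; apply/eqP/indep.
rewrite -quot_class_eq0 quot_class_comb; under eq_bigr do rewrite !mxE scalerBl.
rewrite sumrB -qE -quot_class_comb -quot_classB quot_class_eq0.
by rewrite -opprB rpredN.
Qed.

Lemma socleP p : socle (cls p) <-> forall i, 'X_i * p \in I.
Proof.
split=> [soc i|pI _ [b ->]].
  rewrite -quot_class_eq0 quot_classM soc //.
  exists (fun j => if j == i then 1 else 0).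
  rewrite (bigD1 i) //= eqxx mul1r big1 ?addr0 // => j /negPf->.
  by rewrite mul0r.
rewrite mulr_suml big1 // => i _; rewrite -mulrA -quot_classM.
by have := pI i; rewrite -quot_class_eq0 => /eqP->; rewrite mulr0.
Qed.

Lemma is_dim_ext (V : lmodType k) (U U' : V -> Prop) d :
  (forall v, U v <-> U' v) -> is_dim U d -> is_dim U' d.
Proof.
move=> UU' [b [Ub bU]]; exists b; split=> [i|v /UU'/bU//]; exact/UU'.
Qed.

Lemma socle_dimP d : is_dim (@socle _ _ I) d <->
  is_dim (fun a => exists2 p, (forall i, 'X_i * p \in I) & a = cls p) d.
Proof.
have socE a : socle a <-> exists2 p, (forall i, 'X_i * p \in I) & a = cls p.
  split=> [|[p hp ->]]; last by apply/(socleP p).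
  by have [p ->] := quot_class_surj a; move/(socleP p) => hp; exists p.
by split; apply: is_dim_ext => a; split=> /socE.
Qed.

End QuotientAlgebra.

(** * The annihilator as a proper ideal *)

Section AnnihilatorIdeal.
Variables (k : fieldType) (e n : nat) (phi : {scalar {mpoly k[n]}}).
Hypotheses (phi_e : concentrated e phi) (phi_neq0 : exists p, phi p != 0).

(** The finite test by [pairings] gives the boolean predicate that an [idealr] requires. *)
Definition annih_pred : pred {mpoly k[n]} := fun p => pairings e phi p == 0.

Lemma annih_idealr_closed : idealr_closed annih_pred.
Proof.
split=> [||a p q]; rewrite !unfold_in /annih_pred.
- by rewrite raddf0.
- apply/(pairings_eq0 phi_e) => ann; case: phi_neq0 => p /eqP[].
  by rewrite -[p]mul1r ann.
- move=> /(pairings_eq0 phi_e) hp /(pairings_eq0 phi_e) hq.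
  by apply/(pairings_eq0 phi_e)/annihD => //; apply: annihMl.
Qed.

Definition annih_ideal : idealr {mpoly k[n]} :=
  HB.pack_for (idealr {mpoly k[n]}) annih_pred
    (isIdealr.Build _ annih_pred annih_idealr_closed).

Lemma mem_annih_ideal p : reflect (annih phi p) (p \in annih_ideal).
Proof. exact: pairings_eq0. Qed.

End AnnihilatorIdeal.

(** * Macaulay duality: from a form to a Gorenstein algebra *)

Section FormToAlgebra.
Variables (k : fieldType) (e : nat).

Section OneForm.
Variables (n : nat) (phi : {scalar {mpoly k[n]}}).
Hypotheses (phi_e : concentrated e phi) (phi_neq0 : exists p, phi p != 0).
Local Notation I := (annih_ideal phi_e phi_neq0).
Local Notation cls := (quot_class I).
Local Notation annihP := (mem_annih_ideal phi_e phi_neq0 _).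

Lemma annih_ideal_hilbert : hilbert_function I (hilb e phi).
Proof.
move=> j; apply/(@is_dim_quotP _ _ _ (fun p => p \is j.-homog)) => [|].
  exact: dhomog0.
have [p [hp indep span]] := hilb_basis phi_e j.
exists p; split=> // [c /annihP|q hq]; first exact: indep.
by have [c ann] := span q hq; exists c; apply/annihP.
Qed.

Lemma annih_ideal_finite : finite_dimensional I.
Proof.
have [p [_ indep span]] := catalecticant_basis phi_e predT.
exists (\rank (catalecticant e phi predT)).
apply: (@is_dim_ext _ _ (fun a => exists2 p, True & a = cls p)) => [a|].
  by split=> // _; have [q] := quot_class_surj a; exists q.
apply/is_dim_quotP => //; exists p; split=> // [c /annihP|q _].
  exact: indep.
have [|c ann] := span q; first exact: all_predT.
by exists c; apply/annihP.
Qed.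

Lemma annih_ideal_homogeneous : homogeneous_ideal I.
Proof.
by move=> p d /annihP ann; apply/annihP; apply: (annih_pihomog phi_e).
Qed.

(** The socle is spanned by a degree [e] element [g] with [phi g = 1]. If every variable times [q]
    annihilates [phi], then [q] and [phi q *: g] pair equally with 1 and both pair to zero with all
    other monomials. *)
Lemma annih_ideal_gorenstein : gorenstein I.
Proof.
have [p php] := phi_neq0; pose g := (phi p)^-1 *: pihomog mdeg e p.
have hg : g \is e.-homog by rewrite rpredZ // pihomogP.
have phig : phi g = 1.
  by rewrite /g linearZ /= -concentrated_pihomog // mulVf.
have gX (m : 'X_{1..n}) : m != 0%MM -> phi (g * 'X_[m]) = 0.
  rewrite -mdeg_eq0 => m0.
  apply: (@concentrated_homog _ _ _ _ phi_e (e + mdeg m)).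
    by apply: dhomogM; rewrite // dhomogX.
  by rewrite -[X in _ != X]addn0 eqn_add2l.
apply/socle_dimP/is_dim_quotP => [i|]; first by rewrite mulr0 idealr0.
exists (fun _ => g); split=> [_ i|c|q hq].
- apply/annihP/(annih_monomials phi_e) => m _.
  rewrite mulrAC mulrC -mpolyXD gX // -mdeg_eq0 mdegD mdeg1; lia.
- rewrite big_ord1 => /annihP/(_ 1); rewrite mulr1 linearZ /= phig mulr1 => c0.
  by apply/rowP => i; rewrite ord1 c0 mxE.
exists (\row__ phi q); rewrite big_ord1 mxE.
apply/annihP/(annih_monomials phi_e) => m _.
rewrite mulrBl raddfB /= -scalerAl linearZ /=.
have [->|m0] := eqVneq m 0%MM.
  by rewrite mpolyX0 !mulr1 phig mulr1 subrr.
rewrite gX // mulr0 subr0.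
have [/forallP m0'|] := boolP [forall i, m i == 0%N].
  by case/eqP: m0; apply/mnmP => i; rewrite mnmE; apply/eqP.
rewrite negb_forall => /existsP[i mi].
have -> : m = (U_(i) + (m - U_(i)))%MM.
  rewrite addmC submK //; apply/mnm_lepP => j; rewrite mnmE.
  by case: eqP => [<-|//]; rewrite lt0n.
by rewrite mpolyXD mulrA [q * _]mulrC; have /annihP-> := hq i.
Qed.

End OneForm.

Lemma gorenstein_of_form n (phi : {scalar {mpoly k[n]}}) (h : 'I_e.+1 -> int) :
    concentrated e phi -> nondegenerate phi -> (exists p, phi p != 0) ->
    (forall j, h j = (hilb e phi j)%:Z) ->
  gorenstein_hilbert_function k h.
Proof.
move=> phi_e phi_nd phi_neq0 hE.
exists n, (annih_ideal phi_e phi_neq0), (hilb e phi); split=> //.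
- split; first exact: annih_ideal_homogeneous; last exact: annih_ideal_finite.
  by move=> p hp /mem_annih_ideal; apply: phi_nd.
- exact: annih_ideal_gorenstein.
- exact: annih_ideal_hilbert.
split=> [|j ej].
  have := hilb_sym phi_e (leq0n e); rewrite subn0 => ->.
  by have [p /(hilb0 phi_e)->] := phi_neq0.
apply/eqP; rewrite -leqn0.
apply: (@hilb_le_span _ _ _ _ phi_e j 0 (fun _ => 0)) => q hq; exists 0.
by rewrite big_ord0 subr0; apply: annih_high hq ej.
Qed.

End FormToAlgebra.

(** * Macaulay duality: from a Gorenstein algebra to a form *)

Section AlgebraToForm.
Variables (k : fieldType) (e r : nat).
Variables (I : idealr {mpoly k[r]}) (H : nat -> nat).
Hypothesis I_homog : homogeneous_ideal I.
Hypotheses (I_gor : gorenstein I) (I_hilb : hilbert_function I H).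
Hypothesis I_soc : socle_degree H e.
Local Notation cls := (quot_class I).

Let pieceP j :=
  @is_dim_quotP _ _ I (fun p => p \is j.-homog) (H j) (dhomog0 k mdeg j).

Lemma ideal_high d p : p \is d.-homog -> (e < d)%N -> p \in I.
Proof.
move=> hp ed; have [q [_ _ span]] := (pieceP d).1 (I_hilb d).
have [c] := span p hp; rewrite big1 ?subr0 // => i _.
by have := ltn_ord i; rewrite [X in (_ < X)%N](I_soc.2 d ed).
Qed.

(** Degree [e.+1] lies in [I], so a nonzero class of degree [e] is in the socle, and it spans
    because the socle is a line. *)
Lemma socle_generator : exists g, [/\ g \is e.-homog, g \notin I &
  forall p, (forall i, 'X_i * p \in I) -> exists c, p - c *: g \in I].
Proof.
have [q [hq indep _]] := (pieceP e).1 (I_hilb e).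
have {}hq i : q i \is e.-homog := hq i.
pose i0 := Ordinal I_soc.1.
set g := q i0; have /socle_dimP/is_dim_quotP[|s [_ _ span]] := I_gor.
  by move=> i; rewrite mulr0 idealr0.
have gI : g \notin I.
  apply/negP => gI; suff /rowP/(_ i0)/eqP : delta_mx 0 i0 = 0 :> 'rV[k]_(H e).
    by rewrite !mxE !eqxx oner_eq0.
  apply: indep; rewrite (bigD1 i0) //= mxE !eqxx scale1r big1 ?addr0 // => j ji.
  by rewrite mxE (negPf ji) andbF scale0r.
have [|c] := span g.
  move=> i; apply: (@ideal_high e.+1) => //.
  by rewrite -add1n; apply: dhomogM (hq i0); rewrite dhomogX /= mdeg1.
rewrite big_ord1; set s0 := s _ => gs; exists g.
split=> [||p hp]; [exact: hq|exact: gI|].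
have [c'] := span p hp; rewrite big_ord1 -/s0 => ps.
have c0 : c 0 0 != 0.
  by apply: contraNneq gI => c0; move: gs; rewrite c0 scale0r subr0.
exists (c' 0 0 / c 0 0).
have -> : p - (c' 0 0 / c 0 0) *: g =
    (p - c' 0 0 *: s0) - (c' 0 0 / c 0 0)%:MP * (g - c 0 0 *: s0).
  by rewrite mul_mpolyC scalerBr scalerA divfK // opprB addrA subrK.
by rewrite rpredB // idealMr.
Qed.

Lemma homog_mem_ideal d p g c : p \is d.-homog -> g \is e.-homog -> d != e ->
  p - c *: g \in I -> p \in I.
Proof.
move=> hp hg de /(I_homog d); rewrite raddfB /= linearZ /= pihomog_dE //.
by rewrite (pihomog_ne0 _ hg) 1?eq_sym // scaler0 subr0.
Qed.

(** [phi p] is the coordinate, along the socle generator [g], of the degree [e] component of [p]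
    modulo [I]. *)
Lemma dual_form : exists phi : {scalar {mpoly k[r]}},
  [/\ concentrated e phi, exists p, phi p != 0 &
    forall d p, p \is d.-homog -> (p \in I) <-> annih phi p].
Proof.
have [g [hg gI span]] := socle_generator.
have coefP p : exists c, pihomog mdeg e p - c *: g \in I.
  apply: span => i; apply: (@ideal_high e.+1) => //; rewrite -add1n.
  by apply: dhomogM; [rewrite dhomogX /= mdeg1|apply: pihomogP].
pose f p := xchoose (coefP p).
have fP p : pihomog mdeg e p - f p *: g \in I := xchooseP (coefP p).
have f_uniq p c : pihomog mdeg e p - c *: g \in I -> f p = c.
  move=> pc; apply/eqP; apply: contraNT gI => fc.
  have := rpredB pc (fP p); rewrite opprB addrC addrA subrK -scalerBl.
  rewrite -subr_eq0 in fc => /(idealMr (f p - c)^-1%:MP).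
  by rewrite mul_mpolyC scalerA mulVf // scale1r.
have f_linear : scalar f.
  move=> c p q; apply: f_uniq; rewrite linearP /= scalerDl -scalerA.
  rewrite opprD addrACA -scalerBr rpredD // -mul_mpolyC.
  by rewrite idealMr.
pose phi : {scalar {mpoly k[r]}} :=
  HB.pack f (GRing.isLinear.Build _ _ _ _ f f_linear).
have phi_e : concentrated e phi.
  move=> m me; apply: f_uniq; rewrite pihomogX (negPf me) scale0r subr0.
  exact: idealr0.
have phiI p : p \in I -> phi p = 0.
  by move=> pI; apply: f_uniq; rewrite scale0r subr0; apply: I_homog.
exists phi; split=> //.
  exists g; rewrite [phi g](_ : _ = 1) ?oner_eq0 //.
  by apply: f_uniq; rewrite pihomog_dE // scale1r subrr idealr0.
move=> d p hp; split=> [pI q|]; first by apply: phiI; rewrite mulrC idealMr.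
(* Descending induction on the degree: below [e], all multiples of [p] by variables lie in [I], so
   [p] is a multiple of [g] modulo [I], and comparing degrees puts [p] in [I]. *)
have [m] := ubnP (e.+1 - d); elim: m => // m IH in d p hp *.
move=> dm ann; have [ed|de] := ltnP e d; first exact: ideal_high hp ed.
have [ed|ed] := eqVneq d e.
  have := fP p; rewrite -[f p]/(phi p) pihomog_dE -?ed //.
  by rewrite -[p in phi p]mulr1 ann scale0r subr0.
have [i|c pc] := span p; last exact: homog_mem_ideal hp hg ed pc.
apply: (IH d.+1); last exact: annihMl; last by lia.
by rewrite -add1n; apply: dhomogM; rewrite // dhomogX /= mdeg1.
Qed.

End AlgebraToForm.

Lemma form_of_gorenstein (k : fieldType) e (h : 'I_e.+1 -> int) :
    gorenstein_hilbert_function k h ->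
  exists n (phi : {scalar {mpoly k[n]}}),
    [/\ concentrated e phi, nondegenerate phi, exists p, phi p != 0 &
        forall j, h j = (hilb e phi j)%:Z].
Proof.
case=> r [I [H [[I_homog I_nolin _] I_gor I_hilb I_soc hE]]].
have [phi [phi_e phi_neq0 phiI]] := dual_form I_homog I_gor I_hilb I_soc.
exists r, phi; split=> // [p hp /phiI|j].
  by move=> /(_ _ hp)/(I_nolin _ hp).
rewrite hE; congr (_%:Z).
have [p [hp indep span]] :=
  (is_dim_quotP I (H j) (dhomog0 k mdeg j)).1 (I_hilb j).
have {}hp i : p i \is j.-homog := hp i.
apply/eqP; rewrite eqn_leq; apply/andP; split.
  apply: (indep_le_hilb phi_e hp) => c ann; apply/indep/(phiI j) => //.
  by apply: rpred_sum => i _; apply: rpredZ; apply: hp.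
apply: (hilb_le_span phi_e (p := p)) => q hq.
have [c qc] := span q hq; exists c; apply/(phiI j) => //.
by apply: rpredB => //; apply: rpred_sum => i _; apply: rpredZ; apply: hp.
Qed.

(** * Hilbert functions of socle degree at most five *)

Section Profile.
Variables (k : fieldType) (e : nat).
Hypothesis e_le5 : (e <= 5)%N.

(** For [e <= 5] every index up to [e] is within 2 of an end, so symmetry leaves only the entries
    [n] and [a]. The order of the tests settles the overlaps when [e] is small. *)
Definition short_sequence n a j : nat :=
  if (j == 0%N) || (j == e) then 1
  else if (j == 1%N) || (j == (e - 1)%N) then n else a.

Lemma hilb_short n (phi : {scalar {mpoly k[n]}}) j :
    concentrated e phi -> nondegenerate phi -> (exists p, phi p != 0) ->
    (j <= e)%N ->
  hilb e phi j = short_sequence n (hilb e phi 2) j.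
Proof.
move=> phi_e phi_nd [p /(hilb0 phi_e) h0] je; rewrite /short_sequence.
have sym l : (l <= e)%N -> hilb e phi (e - l) = hilb e phi l by exact: hilb_sym.
have h1 := hilb1 phi_e phi_nd.
case: ifP => [/orP[/eqP->//|/eqP->]|j0].
  by rewrite -[X in hilb _ _ X]subn0 sym.
case: ifP => [/orP[/eqP->//|/eqP->]|j1]; first by rewrite sym //; lia.
have [->//|j2] := eqVneq j 2.
have -> : j = (e - 2)%N by lia.
by rewrite sym //; lia.
Qed.

Lemma nondegenerate_neq0 n (phi : {scalar {mpoly k[n]}}) :
  nondegenerate phi -> (0 < n)%N -> exists p, phi p != 0.
Proof.
case: n phi => // n phi nd _; apply: NNPP => no.
have : 'X_ord0 = 0 :> {mpoly k[n.+1]}.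
  apply: nd => [|q]; first by rewrite dhomogX /= mdeg1.
  by apply/eqP; apply: contraPT no => hq []; exists ('X_ord0 * q).
move/(congr1 (fun p => p@_U_(ord0)))/eqP.
by rewrite mcoeffXU eqxx mcoeff0 oner_eq0.
Qed.

Lemma concentrated_nvars n (phi : {scalar {mpoly k[n]}}) :
  concentrated e phi -> (exists p, phi p != 0) -> (0 < e)%N -> (0 < n)%N.
Proof.
case: n phi => // phi phi_e [p php] e0; case/eqP: php.
rewrite (nvar0_mpolyC p) -alg_mpolyC -mpolyX0 linearZ /= phi_e ?mulr0 //.
by rewrite mdeg0 eq_sym -lt0n.
Qed.

(** Restricting [psi] to [N] variables does not increase its quadric rank, which is then raised to
    that of [phi]; [phi] itself certifies the room, as [n <= N]. *)
Lemma restrict_raise n n' N (phi : {scalar {mpoly k[n]}})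
    (psi : {scalar {mpoly k[n']}}) :
    [pchar k] =i pred0 ->
    concentrated e phi -> concentrated e psi -> nondegenerate psi ->
    (n <= N <= n')%N ->
    ((4 <= e)%N -> (hilb e psi 2 <= hilb e phi 2)%N) ->
  exists chi : {scalar {mpoly k[N]}}, [/\ concentrated e chi,
    nondegenerate chi & (4 <= e)%N -> hilb e chi 2 = hilb e phi 2].
Proof.
move=> ch0 phi_e psi_e psi_nd /andP[nN Nn'] le2.
have [w [w1 chi_nd]] := nondegenerate_restrict ch0 psi_nd Nn'.
have chi_e := concentrated_comp psi_e w1.
have [e4|e4] := ltnP 3 e; last by exists (psi \o comp_mpoly w); split=> //; lia.
have [|chi [? ? chi2]] :=
  raise_hilb2 (b := hilb e phi 2) ch0 e4 chi_e chi_nd phi_e nN.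
  rewrite leqnn andbT; apply: leq_trans (le2 e4).
  exact: hilb_comp.
by exists chi; split.
Qed.

End Profile.

(** * Interpolating in the number of variables or in the quadric rank *)

Theorem corollary3p5 (k : fieldType) (hk : [pchar k] =i pred0)
    (e : nat) (e_gt0 : (0 < e)%N) (e_le5 : (e <= 5)%N)
    (i : nat) (i_gt0 : (1 <= i)%N) (i_lt : (i <= e - 1)%N)
    (alpha : int) (alpha_ge2 : 2 <= alpha)
    (h : 'I_e.+1 -> int) (h_first : h ord0 = 1) (h_last : h ord_max = 1) :
  gorenstein_hilbert_function k h ->
  gorenstein_hilbert_function k (shift_sym i alpha h) ->
  forall beta : int, 1 <= beta -> beta <= alpha - 1 ->
    gorenstein_hilbert_function k (shift_sym i beta h).
Proof.
case/form_of_gorenstein => n [phi [phi_e phi_nd phi0 hE]].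
case/form_of_gorenstein => n' [psi [psi_e psi_nd psi0 hE']] beta beta1 betaa.
have {hE} hE j : h j = (short_sequence e n (hilb e phi 2) j)%:Z.
  by rewrite hE hilb_short // -ltnS.
have {hE'} hE' j :
    shift_sym i alpha h j = (short_sequence e n' (hilb e psi 2) j)%:Z.
  by rewrite hE' hilb_short // -ltnS.
have lt1 : (1 < e.+1)%N by lia.
have at1 := hE' (Ordinal lt1).
have at2 (e4 : (2 < e.+1)%N) := hE' (Ordinal e4).
rewrite /shift_sym hE /short_sequence /= in at1.
have {}at2 : (4 <= e)%N -> if (2 == i) || (2 == e - i)%N
   then (hilb e phi 2)%:Z + alpha = (hilb e psi 2)%:Z
   else hilb e phi 2 = hilb e psi 2.
  move=> e4; have l2 : (2 < e.+1)%N by lia.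
  move: (at2 l2); rewrite /shift_sym hE /short_sequence /=.
  move: (hilb e phi 2) (hilb e psi 2) => a a'; do !case: ifP => ?; lia.
(* Here the number of variables moves, from [n] to [n + alpha], and for [4 <= e] the quadric rank is
   fixed: [psi] is cut down to [n + beta] variables. *)
have [i1|i1] := boolP ((1 == i) || (1 == e - i))%N.
  pose N := (n + `|beta|)%N.
  have n'E : n'%:Z = n%:Z + alpha by move: at1; do !case: ifP => ?; lia.
  have [||chi [chi_e chi_nd chi2]] :=
    @restrict_raise _ e n n' N phi psi hk phi_e psi_e psi_nd.
  - rewrite /N; lia.
  - by move=> e4; move: (at2 e4); case: ifP => [|_ ->//]; lia.
  have chi0 : exists p, chi p != 0.
    by apply: nondegenerate_neq0 => //; rewrite /N; lia.
  apply: (gorenstein_of_form chi_e chi_nd chi0) => j.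
  have je : (j <= e)%N by rewrite -ltnS.
  rewrite hilb_short // /shift_sym hE /short_sequence.
  have [e4|e4] := ltnP 3 e.
    by rewrite (chi2 e4); rewrite /N; do !case: ifP => ?; lia.
  by rewrite /N; do !case: ifP => ?; lia.
(* Now the number of variables is fixed and the entry at 2 moves, which forces [4 <= e]: the quadric
   rank of [phi] is raised by [beta], with [psi] certifying the room. *)
have n'E : n' = n by move: at1; do !case: ifP => ?; lia.
subst n'.
have e4 : (4 <= e)%N by lia.
have i2 : (2 == i) || (2 == e - i)%N by lia.
have psi2 : (hilb e phi 2)%:Z + alpha = (hilb e psi 2)%:Z.
  by move: (at2 e4); rewrite i2.
have [|chi [chi_e chi_nd chi2]] :=
  raise_hilb2 (b := (hilb e phi 2 + `|beta|)%N) hk e4 phi_e phi_nd psi_e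
    (leqnn n); first lia.
have n0 : (0 < n)%N.
  exact: concentrated_nvars phi_e phi0 e_gt0.
have chi0 := nondegenerate_neq0 chi_nd n0.
apply: (gorenstein_of_form chi_e chi_nd chi0) => j.
have je : (j <= e)%N by rewrite -ltnS.
rewrite hilb_short // chi2 /shift_sym hE /short_sequence.
by do !case: ifP => ?; lia.
Qed.
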